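(* Suppose $n\le m$. Let $\mu=\mathcal{N}(m_0,\Sigma_0)$ and $\nu=\mathcal{N}(m_1,\Sigma_1)$ be two Gaussian measures on $\mathbb{R}^m$ and $\mathbb{R}^n$ respectively. Let $\Sigma_0=P_0D_0P_0^T$ and $\Sigma_1=P_1D_1P_1^T$ be diagonalizations ($P_0,P_1$ orthogonal, $D_0,D_1$ diagonal) which sort the eigenvalues in decreasing order. Suppose that $\Sigma_0$ is non-singular. Then $$GW_2^2(\mu,\nu)\ \ge\ LGW_2^2(\mu,\nu),$$ where $$LGW_2^2(\mu,\nu)=4\left(\mathrm{tr}(D_0)-\mathrm{tr}(D_1)\right)^2+4\left(\|D_0\|_{\mathcal{F}}-\|D_1\|_{\mathcal{F}}\right)^2+4\|D_0^{(n)}-D_1\|_{\mathcal{F}}^2+4\left(\|D_0\|_{\mathcal{F}}^2-\|D_0^{(n)}\|_{\mathcal{F}}^2\right).$$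
   Context: For probability measures $\mu$ on $\mathbb{R}^m$ and $\nu$ on $\mathbb{R}^n$, $$GW_2^2(\mu,\nu)=\inf_{\pi\in\Pi(\mu,\nu)}\int\int\left(\|x-x'\|_{\mathbb{R}^m}^2-\|y-y'\|_{\mathbb{R}^n}^2\right)^2d\pi(x,y)\,d\pi(x',y'),$$ where $\Pi(\mu,\nu)$ is the set of probability measures on $\mathbb{R}^m\times\mathbb{R}^n$ with marginals $\mu$ and $\nu$, and $\|\cdot\|_{\mathbb{R}^d}$ is the Euclidean norm. $\|M\|_{\mathcal{F}}=\sqrt{\mathrm{tr}(M^TM)}$ is the Frobenius norm. For $A\in\mathbb{R}^{m\times m}$ and $n\le m$, $A^{(n)}\in\mathbb{R}^{n\times n}$ is the submatrix of the first $n$ rows and first $n$ columns of $A$. ''Decreasing'' means non-increasing. Gaussian measures may be degenerate (singular covariance). *)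

(* Defs.v *)
From mathcomp Require Import all_boot all_order all_algebra.
From mathcomp Require Import all_classical all_reals all_analysis.

Set Implicit Arguments.
Unset Strict Implicit.
Unset Printing Implicit Defensive.

Import Order.TTheory GRing.Theory Num.Theory.

Local Open Scope classical_set_scope.
Local Open Scope ring_scope.

(* R^d is [d.-tuple R]: its product sigma-algebra, provided by the library, is
   the Borel one.  Type 'rV[R]_d carries no measurable structure. *)

Definition dotp {R : realType} {d : nat} (x y : d.-tuple R) : R :=
  \sum_(i < d) tnth x i * tnth y i.

Definition subt {R : realType} {d : nat} (x y : d.-tuple R) : d.-tuple R :=
  [tuple tnth x i - tnth y i | i < d].

Definition norm2 {R : realType} {d : nat} (x : d.-tuple R) : R :=
  Num.sqrt (dotp x x).

Definition quadform {R : realType} {d : nat} (S : 'M[R]_d) (u : d.-tuple R) : R :=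
  \sum_(i < d) \sum_(j < d) tnth u i * S i j * tnth u j.

(* One-dimensional normal law with mean [a] and variance [v >= 0].  The case
   [v = 0] is separate because [normal_prob a 0] is the uniform law on [0, 1],
   and [normal_prob] takes a standard deviation. *)
Definition normal1 {R : realType} (a v : R) : set R -> \bar R :=
  if v == 0 then \d_a else normal_prob a (Num.sqrt v).

(* [mu] is N(a, S), possibly degenerate: S is symmetric positive semi-definite
   and, for every u, the law of <u, X> is N(<u, a>, u^T S u).  Only measurable
   sets are tested: a measure is unconstrained on the others. *)
Definition is_gaussian {R : realType} {d : nat} (mu : set (d.-tuple R) -> \bar R)
    (a : d.-tuple R) (S : 'M[R]_d) : Prop :=
  [/\ S^T = S,
      forall u : d.-tuple R, 0 <= quadform S u &
      forall (u : d.-tuple R) (B : set R), measurable B ->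
        mu (dotp u @^-1` B) = normal1 (dotp u a) (quadform S u) B].

Definition coupling {R : realType} {m n : nat}
    (mu : probability (m.-tuple R) R) (nu : probability (n.-tuple R) R) :
    set (probability (m.-tuple R * n.-tuple R)%type R) :=
  [set pi |
    (forall A : set (m.-tuple R), measurable A -> pi (fst @^-1` A) = mu A) /\
    (forall B : set (n.-tuple R), measurable B -> pi (snd @^-1` B) = nu B)].

Definition GW2_cost {R : realType} {m n : nat}
    (z z' : m.-tuple R * n.-tuple R) : R :=
  (norm2 (subt z.1 z'.1) ^+ 2 - norm2 (subt z.2 z'.2) ^+ 2) ^+ 2.

Definition GW2_sq {R : realType} {m n : nat}
    (mu : probability (m.-tuple R) R) (nu : probability (n.-tuple R) R) :
    \bar R :=
  ereal_inf [set (\int[pi]_z' \int[pi]_z (GW2_cost z z')%:E)%E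
            | pi in coupling mu nu].

Definition frobenius {R : realType} {p q : nat} (M : 'M[R]_(p, q)) : R :=
  Num.sqrt (\tr (M^T *m M)).

Definition leading_submx {R : realType} {m n : nat} (le_nm : (n <= m)%N)
    (A : 'M[R]_m) : 'M[R]_n :=
  mxsub (widen_ord le_nm) (widen_ord le_nm) A.

Definition LGW2_sq {R : realType} {m n : nat} (le_nm : (n <= m)%N)
    (D0 : 'M[R]_m) (D1 : 'M[R]_n) : R :=
  4 * (\tr D0 - \tr D1) ^+ 2
  + 4 * (frobenius D0 - frobenius D1) ^+ 2
  + 4 * frobenius (leading_submx le_nm D0 - D1) ^+ 2
  + 4 * (frobenius D0 ^+ 2 - frobenius (leading_submx le_nm D0) ^+ 2).

Definition orthogonal_mx {R : realType} {d : nat} (P : 'M[R]_d) : Prop :=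
  P *m P^T = 1%:M /\ P^T *m P = 1%:M.

Definition sorted_diagonalization {R : realType} {d : nat}
    (S P D : 'M[R]_d) : Prop :=
  [/\ orthogonal_mx P, is_diag_mx D,
      forall i j : 'I_d, (i <= j)%N -> D j j <= D i i &
      S = P *m D *m P^T].

(* Main.v *)
Require Import Defs.
From mathcomp Require Import all_boot all_order all_algebra.
From mathcomp Require Import all_classical all_reals all_analysis.
From mathcomp Require Import measurable_realfun ring lra.

Set Implicit Arguments.
Unset Strict Implicit.
Unset Printing Implicit Defensive.

Import Order.TTheory GRing.Theory Num.Theory.
Import numFieldNormedType.Exports.

Local Open Scope classical_set_scope.
Local Open Scope ring_scope.

(** Fix a coupling and write x, y for the coordinates of the two centred vectors
    in the eigenbases of their covariances.  With G = |x|^2 - |y|^2 the cost is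
    the square of
      G(z) + G(z') - 2 (sum_i x_i(z) x_i(z') - sum_j y_j(z) y_j(z')),
    a finite sum of products of a function of z and a function of z'.  Its
    double integral therefore only involves L2 inner products, and since x, y
    have mean zero ([quadratic_cost_integral]) it equals
      2 E[G^2] + 2 E[G]^2
        + 4 (sum_ik E[x_i x_k]^2 + sum_jl E[y_j y_l]^2 - 2 sum_ij E[x_i y_j]^2).
    The coupling enters through two quantities only, the covariance of |x|^2
    and |y|^2 inside E[G^2], and the last sum; both are bounded above.

    The Gaussian hypothesis gives E[x_i x_k], E|x|^2 and E|x|^4, because every
    linear form of x is N(0, v) and so has fourth moment 3 v^2
    ([normal1_moments]), from which the mixed moments follow by polarization
    ([normal_family_sqr_cov]).  In particular Var |x|^2 = 2 |D0|_F^2, so by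
    Cauchy-Schwarz Cov(|x|^2, |y|^2) <= 2 |D0|_F |D1|_F.

    For the cross-covariance K_ij = E[x_i y_j], Bessel's inequality in L2 says
    that K_ij^2 / (d_i e_j), with d and e the diagonals of D0 and D1, has row
    and column sums at most 1; a rearrangement inequality for such weights
    ([doubly_substochastic_le]) gives sum_ij K_ij^2 <= sum_(j < n) d_j e_j
    ([cross_covariance_le]).  Inserting the two bounds yields exactly the
    claimed lower bound. *)

(** * Moments of the one-dimensional normal law *)

Section real_line.
Context {R : realType}.
Notation lam := (@lebesgue_measure R).

(** The boundary terms of integration by parts on the whole line: the integral
    over [-n, n] is F n - F (- n), and dominated convergence removes the
    truncation. *)
Lemma integral_derive_eq0 (F f : R -> R) :
  (forall x, is_derive x (1 : R) F (f x)) -> continuous f ->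
  F x @[x --> +oo] --> 0 -> F x @[x --> -oo] --> 0 ->
  lam.-integrable setT (EFin \o f) ->
  (\int[lam]_x (f x)%:E = 0)%E.
Proof.
move=> dF cf Fy FNy intf.
have cF : continuous F.
  move=> x; apply/differentiable_continuous; rewrite -derivable1_diffP.
  exact: ex_derive.
pose I (n : nat) : set R := `[- n.+1%:R, n.+1%:R]%classic.
have fE (n : nat) : (\int[lam]_(x in I n) (f x)%:E)%E
    = (F n.+1%:R - F (- n.+1%:R))%:E.
  rewrite (@continuous_FTC2 _ f F) ?EFinB//.
  - by rewrite gtrN.
  - exact: continuous_subspaceT.
  - split => [x _|//|//].
    + exact: ex_derive.
    + by apply: cvg_at_right_filter; exact: cF.
    + by apply: cvg_at_left_filter; exact: cF.
  - by move=> x _; rewrite derive1E; exact: derive_val.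
pose g (n : nat) x := ((EFin \o f) \_ (I n)) x.
have mf : measurable_fun setT f by exact: continuous_measurable_fun.
have [_ _ cvg_g] : [/\ lam.-integrable setT (EFin \o f),
    [sequence \int[lam]_(x in setT) `|g n x - (EFin \o f) x|]_n @ \oo --> 0 &
    [sequence \int[lam]_(x in setT) (g n x)]_n @ \oo -->
      \int[lam]_(x in setT) (EFin \o f) x]%E.
  apply: (@dominated_convergence _ _ _ lam setT measurableT g (EFin \o f)
    (fun x => `|f x|%:E)).
  - move=> n; apply/(measurable_restrictT _ _).1; first exact: measurable_itv.
    by apply/measurable_EFinP/measurable_funTS.
  - exact/measurable_EFinP.
  - apply: nearW => x _; apply: cvg_near_cst.
    near=> n; rewrite /g /patch ifT// inE/= /I/= in_itv/= -ler_norml.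
    apply: (@le_trans _ _ n%:R); last by rewrite ler_nat.
    near: n; exact: nbhs_infty_ger.
  - exact: integrable_norm intf.
  - apply: nearW => x n _; rewrite /g /patch; case: ifPn => // _.
    by rewrite abse0 lee_fin.
have gE : [sequence \int[lam]_(x in setT) (g n x)]_n%E =
    (fun n => (F n.+1%:R - F (- n.+1%:R))%:E).
  apply/funext => n /=; rewrite -fE [RHS]integral_mkcond.
  by [].
rewrite gE in cvg_g.
have : (fun n => (F n.+1%:R - F (- n.+1%:R))%:E) @ \oo --> (0 - 0)%:E.
  apply: cvg_EFin; first exact: nearW.
  rewrite /comp /=; apply: cvgB.
  - have /cvg_pinftyP/(_ _ cvgr_idn) := Fy.
    by rewrite -(cvg_shiftS (fun n => F n%:R)).
  - have /cvg_ninftyP H := FNy.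
    have := H (fun n : nat => - n%:R).
    rewrite -(cvg_shiftS (fun n => F (- n%:R))); apply.
    apply/(@cvgNrNy _ nat _ _ (fun n : nat => n%:R)); exact: cvgr_idn.
rewrite subr0 => /(cvg_unique _ cvg_g) ->//.
Unshelve. all: end_near. Qed.

End real_line.

Section normal_prob_integral.
Context {R : realType}.
Variables (a s : R).
Notation lam := (@lebesgue_measure R).

(** A probability defined by integrating a density has that density as
    Radon-Nikodym derivative, up to a null set; changing variables with the
    derivative then turns it into the density itself. *)
Lemma normal_prob_integral (f : R -> R) : measurable_fun setT f ->
  lam.-integrable setT (fun x => (f x * normal_pdf a s x)%:E) ->
  (normal_prob a s).-integrable setT (EFin \o f) /\
  \int[normal_prob a s]_x f x = \int[lam]_x (f x * normal_pdf a s x).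
Proof.
move=> mf intf.
have dom := normal_prob_dominates a s.
have mpdf := measurable_normal_pdf a s.
have intN : (normal_prob a s).-integrable setT (EFin \o f).
  apply/integrableP; split; first exact/measurable_EFinP.
  rewrite -(Radon_Nikodym_SigmaFinite.change_of_variables dom)//; last first.
    by apply: measurableT_comp => //; exact/measurable_EFinP.
  have /integrableP[_] := intf; apply: le_lt_trans.
  rewrite [leRHS](_ : _ =
      \int[lam]_x (`|(f x)%:E| * (normal_pdf a s x)%:E))%E; last first.
    apply: eq_integral => x _; rewrite EFinM abseM.
    by rewrite [in X in (_ * X)%E = _]gee0_abs// lee_fin normal_pdf_ge0.
  rewrite le_eqVlt; apply/orP; left; apply/eqP.
  apply: ae_eq_integral => //.
  - apply: emeasurable_funM.
      by apply: measurableT_comp => //; exact/measurable_EFinP.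
    by apply: measurable_int; exact: Radon_Nikodym_SigmaFinite.f_integrable.
  - apply: emeasurable_funM; last exact/measurable_EFinP.
    by apply: measurableT_comp => //; exact/measurable_EFinP.
  - apply: ae_eqe_mul2l.
    apply: integral_ae_eq => //.
    + exact: Radon_Nikodym_SigmaFinite.f_integrable.
    + exact/measurable_EFinP.
    + by move=> E _ mE; rewrite -Radon_Nikodym_SigmaFinite.f_integral.
split => //; rewrite /Rintegral; congr fine.
rewrite -(Radon_Nikodym_change_of_variables dom)//.
under [RHS]eq_integral do rewrite EFinM.
apply: ae_eq_integral => //.
- by apply: emeasurable_funM => //; exact/measurable_EFinP.
- by apply: emeasurable_funM => //; exact/measurable_EFinP.
- apply: ae_eqe_mul2l.
  apply: integral_ae_eq => //.
  + exact: Radon_Nikodym_integrable.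
  + exact/measurable_EFinP.
  + by move=> E _ mE; rewrite -Radon_Nikodym_integral//.
Qed.

End normal_prob_integral.

Section normal_moments.
Context {R : realType}.
Variables (a s : R).
Hypothesis s0 : s != 0.
Notation lam := (@lebesgue_measure R).
(* The density version of the central moment of order k. *)
Notation cmom k := (fun x : R => (x - a) ^+ k * normal_pdf a s x).

(** Doubling the standard deviation absorbs any power: the quotient of the two
    densities is a Gaussian factor exp (- 3 (x - a)^2 / (8 s^2)), and the
    exponential series dominates each of its terms. *)
Lemma cmom_bound k : exists C : R,
  0 <= C /\ forall x, `|cmom k x| <= C * normal_pdf a (2 * s) x.
Proof.
have s20 : 2 * s != 0 by rewrite mulf_neq0.
(* 1 / (2 s^2) - 1 / (8 s^2) = 1 / c *)
pose c : R := 8 / 3 * s ^+ 2.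
have c0 : 0 < c by rewrite mulr_gt0// exprn_even_gt0.
have cp0 := normal_peak_gt0 s20.
exists (normal_peak s / normal_peak (2 * s) * (1 + c ^+ k * k`!%:R)); split.
  rewrite mulr_ge0 ?divr_ge0 ?normal_peak_ge0// addr_ge0// mulr_ge0//.
  by rewrite exprn_ge0// ltW.
move=> x; rewrite !normal_pdfE//.
pose t := (x - a) ^+ 2 / c.
have t0 : 0 <= t by rewrite divr_ge0 ?sqr_ge0// ltW.
have powt : (x - a) ^+ k.*2 <= c ^+ k * k`!%:R * expR t.
  have -> : (x - a) ^+ k.*2 = c ^+ k * t ^+ k.
    rewrite -exprMn /t mulrCA divff ?gt_eqF// mulr1 -exprM mulnC.
    by rewrite muln2.
  rewrite -mulrA ler_pM2l ?exprn_gt0//.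
  case: k => [|k]; first by rewrite fact0 mul1r expr0 -expR0 ler_expR.
  rewrite mulrC -ler_pdivrMr ?ltr0n ?fact_gt0//.
  by apply: le_trans (expR_ge1Dxn k t0); rewrite lerDr.
have powx : `|x - a| ^+ k <= (1 + c ^+ k * k`!%:R) * expR t.
  apply: (@le_trans _ _ (1 + (x - a) ^+ k.*2)).
    have -> : (x - a) ^+ k.*2 = (`|x - a| ^+ k) ^+ 2.
      by rewrite -exprM muln2 -!normrX ger0_norm// -muln2 exprM sqr_ge0.
    by have := sqr_ge0 (`|x - a| ^+ k - 1); nra.
  by rewrite mulrDl mul1r lerD// -expR0 ler_expR.
rewrite normrM normrX [X in _ * X]ger0_norm; last first.
  by rewrite mulr_ge0 ?normal_peak_ge0 ?normal_fun_ge0.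
have -> : normal_fun a s x = expR (- t) * normal_fun a (2 * s) x.
  rewrite /normal_fun -expRD; congr expR; rewrite /t /c.
  by field; rewrite s0.
have N0 : 0 <= normal_peak s * normal_fun a (2 * s) x.
  by rewrite mulr_ge0 ?normal_peak_ge0 ?normal_fun_ge0.
have := ler_wpM2r N0 powx; rewrite -(ler_pM2r (expR_gt0 (- t))) => /le_trans.
rewrite -[leRHS]mulrA => le_N.
apply: (le_trans (_ : _ <=
    `|x - a| ^+ k * (normal_peak s * normal_fun a (2 * s) x) * expR (- t))).
  by rewrite le_eqVlt; apply/orP; left; apply/eqP; ring.
apply: le_N; rewrite le_eqVlt; apply/orP; left; apply/eqP.
transitivity ((expR t * expR (- t)) * ((1 + c ^+ k * k`!%:R) *
    (normal_peak s * normal_fun a (2 * s) x))); first by ring.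
rewrite expRxMexpNx_1.
by field; rewrite gt_eqF.
Qed.

Lemma normal_pdf_is_derive x :
  is_derive x (1 : R) (normal_pdf a s) (- (x - a) / s ^+ 2 * normal_pdf a s x).
Proof.
rewrite normal_pdfE// /normal_fun.
apply: is_derive_eq.
rewrite /GRing.scale/=.
by field.
Qed.

Lemma cmom_is_derive k x :
  is_derive x (1 : R) (cmom k)
    (k%:R * cmom k.-1 x - (s ^+ 2)^-1 * cmom k.+1 x).
Proof.
have d1 : is_derive x (1 : R) (fun y : R => y - a) 1.
  by apply: is_derive_eq; rewrite subr0.
have dM := is_deriveM (is_deriveX k d1) (normal_pdf_is_derive x).
rewrite (_ : cmom k = (fun y => y - a) ^+ k * normal_pdf a s)//; last first.
  by apply/funext => y; rewrite fctE/= exprfctE.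
apply: is_derive_eq dM _.
rewrite /GRing.scale/= exprfctE (exprS _ k).
by field.
Qed.

Lemma cmom_integrable k : lam.-integrable setT (EFin \o (cmom k)).
Proof.
have [C [C0 CP]] := cmom_bound k.
apply: (@le_integrable _ _ _ lam setT measurableT _
  (fun x => (C * normal_pdf a (2 * s) x)%:E)).
- apply/measurable_EFinP/measurable_funM; last exact: measurable_normal_pdf.
  by apply: measurable_funX; exact: measurable_funB.
- move=> x _ /=; rewrite lee_fin (le_trans (CP x))//.
  by rewrite ler_norm.
- under eq_fun do rewrite EFinM.
  by apply: integrableZl => //; exact: integrable_normal_pdf.
Qed.

(** Boundedness of the next integrand, with exponent k + 1, forces decay at
    least like 1 / |x - a|. *)
Lemma cmom_cvg0 k :
  cmom k x @[x --> +oo] --> 0 /\ cmom k x @[x --> -oo] --> 0.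
Proof.
have [C [C0 CP]] := cmom_bound k.+1.
have s20 : 2 * s != 0 by rewrite mulf_neq0.
have B x : `|x - a| * `|cmom k x| <= C * normal_peak (2 * s).
  rewrite -normrM mulrA -exprS (le_trans (CP x))//.
  by rewrite ler_wpM2l// normal_pdf_ub.
set M := C * _ in B.
have M0 : 0 <= M by rewrite mulr_ge0 ?normal_peak_ge0.
have small e x : 0 < e -> M / e < `|x - a| -> `|cmom k x| < e.
  move=> e0; rewrite ltr_pdivrMr// => Mlt.
  have xa : 0 < `|x - a|.
    rewrite lt0r normr_ge0 andbT; apply/eqP => xa.
    by move: Mlt; rewrite xa mul0r ltNge M0.
  by rewrite -(ltr_pM2l xa) (le_lt_trans (B x)).
split; apply/cvgr0Pnorm_lt => e e0; near=> x; apply: small => //.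
- apply: lt_le_trans (ler_norm _); rewrite ltrBrDr.
  by near: x; apply: nbhs_pinfty_gt; rewrite num_real.
- rewrite distrC; apply: lt_le_trans (ler_norm _); rewrite ltrBrDr -ltrBrDl.
  by near: x; apply: nbhs_ninfty_lt; rewrite num_real.
Unshelve. all: end_near. Qed.

Lemma cmom_continuous k : continuous (cmom k).
Proof.
move=> x; have /@ex_derive/derivable1_diffP := cmom_is_derive k x.
exact: differentiable_continuous.
Qed.

(** Stein's recursion: integrate the derivative of (x - a)^k times the density.
    For k = 0 the term in k - 1 carries the factor 0, which gives the vanishing
    mean. *)
Lemma cmom_rec k :
  (\int[lam]_x (cmom k.+1 x) = s ^+ 2 * k%:R * \int[lam]_x (cmom k.-1 x))%R.
Proof.
have [cy cNy] := cmom_cvg0 k.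
have i1 := cmom_integrable k.-1.
have i2 := cmom_integrable k.+1.
have z : (\int[lam]_x (k%:R * cmom k.-1 x - (s ^+ 2)^-1 * cmom k.+1 x)%:E)%E = 0%E.
  apply: (integral_derive_eq0 (cmom_is_derive k)) => //.
  - move=> x; apply: cvgB; apply: cvgM; try exact: cvg_cst; exact: cmom_continuous.
  - rewrite (_ : EFin \o _ = (fun x => (k%:R)%:E * (EFin \o cmom k.-1) x
      - ((s ^+ 2)^-1)%:E * (EFin \o cmom k.+1) x)%E)//.
    by apply: integrableB => //; exact: integrableZl.
have : \int[lam]_x (k%:R * cmom k.-1 x - (s ^+ 2)^-1 * cmom k.+1 x) = 0.
  by rewrite /Rintegral z.
rewrite RintegralB//; last 2 first.
  rewrite (_ : EFin \o _ = (fun x => (k%:R)%:E * (EFin \o cmom k.-1) x)%E)//.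
  exact: integrableZl.
  rewrite (_ : EFin \o _ =
    (fun x => ((s ^+ 2)^-1)%:E * (EFin \o cmom k.+1) x)%E)//.
  exact: integrableZl.
rewrite !RintegralZl// => /eqP; rewrite subr_eq0 => /eqP e.
by rewrite -mulrA e mulrA divff ?mul1r// expf_neq0.
Qed.

Lemma cmom0 : \int[lam]_x (cmom 0 x) = 1.
Proof.
rewrite /Rintegral (_ : (fun x => _) = (fun x => (normal_pdf a s x)%:E)).
  by rewrite integral_normal_pdf.
by apply/funext => x; rewrite expr0 mul1r.
Qed.

Lemma normal_prob_cmom k :
  (normal_prob a s).-integrable setT (fun x => ((x - a) ^+ k)%:E) /\
  \int[normal_prob a s]_x (x - a) ^+ k = \int[lam]_x (cmom k x).
Proof.
apply: normal_prob_integral; last exact: cmom_integrable.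
by apply: measurable_funX; exact: measurable_funB.
Qed.

End normal_moments.

Section image_measure.
Context {R : realType} d (T : measurableType d) (P : probability T R).

Lemma integral_law (N : probability (measurableTypeR R) R)
    (f : T -> measurableTypeR R) (g : measurableTypeR R -> R) :
  measurable_fun setT f -> measurable_fun setT g ->
  (forall B, measurable B -> P (f @^-1` B) = N B) ->
  N.-integrable setT (EFin \o g) ->
  P.-integrable setT (EFin \o (g \o f)) /\ \int[P]_x g (f x) = \int[N]_y g y.
Proof.
move=> mf mg law intg.
have intgf : P.-integrable setT (EFin \o (g \o f)).
  apply/integrableP; split.
    by apply/measurable_EFinP; exact: measurableT_comp.
  have /integrableP[_] := intg; apply: le_lt_trans.
  rewrite -(eq_measure_integral N (m1 := pushforward P f))//; last first.
    by move=> A mA _; exact: law.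
  rewrite ge0_integral_pushforward//.
  by apply: measurableT_comp => //; exact/measurable_EFinP.
split => //; rewrite /Rintegral; congr fine.
rewrite -(eq_measure_integral N (m1 := pushforward P f))//; last first.
  by move=> A mA _; exact: law.
by rewrite integral_pushforward//; exact/measurable_EFinP.
Qed.

(** The degenerate law is a point mass, for which all central moments vanish;
    otherwise the recursion gives 1, 0, v, 0, 3 v^2. *)
Lemma normal1_moments (f : T -> R) (a v : R) :
  measurable_fun setT f -> 0 <= v ->
  (forall B, measurable B -> P (f @^-1` B) = normal1 a v B) ->
  [/\ forall k, P.-integrable setT (fun x => ((f x - a) ^+ k)%:E),
      \int[P]_x (f x - a) = 0,
      \int[P]_x (f x - a) ^+ 2 = v &
      \int[P]_x (f x - a) ^+ 4 = 3 * v ^+ 2].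
Proof.
move=> mf v0 law.
have mq k : measurable_fun [set: measurableTypeR R] (fun y : R => (y - a) ^+ k).
  by apply: measurable_funX; exact: measurable_funB.
suff [N [lawN [intN [N1 N2 N4]]]] : exists N : probability (measurableTypeR R) R,
    (forall B, measurable B -> P (f @^-1` B) = N B) /\
    (forall k, N.-integrable setT (EFin \o (fun y : R => (y - a) ^+ k))) /\
    [/\ \int[N]_y (y - a) ^+ 1 = 0, \int[N]_y (y - a) ^+ 2 = v &
        \int[N]_y (y - a) ^+ 4 = 3 * v ^+ 2].
  have tr k := integral_law mf (mq k) lawN (intN k).
  split => [k|||].
  - exact: (tr k).1.
  - by rewrite -N1 -(tr 1%N).2.
  - by rewrite -N2 -(tr 2%N).2.
  - by rewrite -N4 -(tr 4%N).2.
move: law; rewrite /normal1; case: eqP => [v_eq0|/eqP v_neq0] law.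
  exists (\d_(a : measurableTypeR R) : probability (measurableTypeR R) R).
  split => //.
  have val k : \int[\d_(a : measurableTypeR R)]_y (y - a) ^+ k = 0 ^+ k.
    rewrite /Rintegral integral_dirac//; last exact/measurable_EFinP.
    by rewrite diracT mul1e /= subrr.
  split => [k|].
    apply/integrableP; split; first exact/measurable_EFinP.
    rewrite integral_dirac//; last first.
      by apply: measurableT_comp => //; exact/measurable_EFinP.
    by rewrite diracT mul1e ltry.
  by rewrite !val v_eq0 !expr0n/= mulr0.
have s0 : Num.sqrt v != 0 by rewrite sqrtr_eq0 -ltNge lt0r v_neq0.
exists (normal_prob a (Num.sqrt v) : probability (measurableTypeR R) R); split => //.
have tr k := normal_prob_cmom a s0 k.
split => [k|]; first exact: (tr k).1.
by rewrite !(tr _).2 !(cmom_rec a s0)/= cmom0// sqr_sqrtr// mulr0 mul0r; split=> //; ring.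
Qed.

End image_measure.

(** * The inner product of square-integrable functions *)

Section square_integrable.
Context {R : realType} d (T : measurableType d) (P : probability T R).
Implicit Types f g : T -> R.

Definition inner f g : R := \int[P]_x (f x * g x).

Lemma innerC f g : inner f g = inner g f.
Proof. by rewrite /inner; under eq_Rintegral do rewrite mulrC. Qed.

Lemma Lfun2_of_sqr f : measurable_fun setT f ->
  P.-integrable setT (EFin \o (fun x => f x ^+ 2)) -> f \in Lfun P 2%:E.
Proof.
move=> mf /integrableP[_ intf]; rewrite inE; apply/andP; split; rewrite inE//=.
rewrite /finite_norm unlock poweR_lty//.
apply: le_lt_trans intf; rewrite le_eqVlt; apply/orP; left; apply/eqP.
by apply: eq_integral => x _ /=; rewrite powR_mulrn// normrX.
Qed.

Lemma inner_integrable f g : f \in Lfun P 2%:E -> g \in Lfun P 2%:E ->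
  P.-integrable setT (fun x => (f x * g x)%:E).
Proof. by move=> Lf Lg; apply/Lfun1_integrable; exact: Lfun2_mul_Lfun1. Qed.

Lemma integral_lincomb (I : finType) (c : I -> R) (f : I -> T -> R) :
  (forall i, P.-integrable setT (EFin \o f i)) ->
  (\int[P]_x (\sum_i c i * f i x)%:E)%E = (\sum_i c i * \int[P]_x f i x)%:E.
Proof.
move=> intf.
have intcf i : P.-integrable setT (fun x => (c i)%:E * (EFin \o f i) x)%E.
  exact: integrableZl.
under eq_integral do rewrite -sumEFin.
rewrite (integral_sum measurableT intcf) -sumEFin; apply: eq_bigr => i _.
rewrite integralZl// EFinM; congr (_ * _)%E.
rewrite /Rintegral fineK//; apply: integrable_fin_num => //; exact: intf.
Qed.

Lemma Rintegral_lincomb (I : finType) (c : I -> R) (f : I -> T -> R) :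
  (forall i, P.-integrable setT (EFin \o f i)) ->
  \int[P]_x (\sum_i c i * f i x) = \sum_i c i * \int[P]_x f i x.
Proof. by move=> intf; rewrite /Rintegral integral_lincomb. Qed.

Lemma inner11 : inner (cst 1) (cst 1) = 1.
Proof.
rewrite /inner; under eq_Rintegral do rewrite mulr1.
rewrite Rintegral_cst// mul1r -[RHS]/(fine 1%E); congr fine.
exact: probability_setT.
Qed.

Lemma Lfun2_sum (I : finType) (f : I -> T -> R) :
  (forall i, f i \in Lfun P 2%:E) -> (fun z => \sum_i f i z) \in Lfun P 2%:E.
Proof.
have le12 : (1 <= 2%:E :> \bar R)%E by rewrite lee_fin ler1n.
move=> Lf; rewrite (_ : (fun z => _) = \sum_i f i); last first.
  by apply/funext => z; rewrite fct_sumE.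
by apply: rpred_sum => i _; exact: Lf.
Qed.

Lemma Lfun2_lin f g (c : R) : f \in Lfun P 2%:E -> g \in Lfun P 2%:E ->
  (fun x => f x + c * g x) \in Lfun P 2%:E.
Proof.
move=> Lf Lg; have le12 : (1 <= 2%:E :> \bar R)%E by rewrite lee_fin ler1n.
rewrite (_ : (fun x => _) = f + (fun x => c * g x))//; apply: rpredD => //.
rewrite (_ : (fun x => _) = c \o* g); last by apply/funext => x; rewrite /= mulrC.
by apply: Lfun_scale; rewrite ?ler1n.
Qed.

Lemma inner_linl f g h (c : R) : f \in Lfun P 2%:E -> g \in Lfun P 2%:E ->
  h \in Lfun P 2%:E ->
  inner (fun x => f x + c * g x) h = inner f h + c * inner g h.
Proof.
move=> Lf Lg Lh.
have := @Rintegral_lincomb bool (fun b => if b then 1 else c)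
  (fun b x => (if b then f x else g x) * h x).
rewrite big_bool/= mul1r => <-.
  by apply: eq_Rintegral => x _; rewrite big_bool/=; ring.
by case; exact: inner_integrable.
Qed.

Lemma inner_linr f g h (c : R) : f \in Lfun P 2%:E -> g \in Lfun P 2%:E ->
  h \in Lfun P 2%:E ->
  inner h (fun x => f x + c * g x) = inner h f + c * inner h g.
Proof. by move=> Lf Lg Lh; rewrite innerC inner_linl// !(innerC _ h). Qed.

Lemma inner_ge0 f : 0 <= inner f f.
Proof. by apply: Rintegral_ge0 => x _; rewrite -expr2 sqr_ge0. Qed.

Lemma inner_cauchy_schwarz f g : f \in Lfun P 2%:E -> g \in Lfun P 2%:E ->
  inner f g ^+ 2 <= inner f f * inner g g.
Proof.
move=> Lf Lg.
have quad c : 0 <= inner f f + 2 * c * inner f g + c ^+ 2 * inner g g.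
  have := inner_ge0 (fun x => f x + c * g x).
  rewrite inner_linl ?inner_linr ?Lfun2_lin// (innerC g f).
  by congr (_ <= _); ring.
have [gg0|gg0] := eqVneq (inner g g) 0.
  have [->|fg0] := eqVneq (inner f g) 0.
    by rewrite expr0n/= mulr_ge0// inner_ge0.
  have := quad (- (inner f f + 1) / (2 * inner f g)).
  rewrite gg0 (_ : _ + _ = -1) ?ler0N1//.
  by field.
have gg_gt0 : 0 < inner g g by rewrite lt0r gg0 inner_ge0.
have := quad (- inner f g / inner g g).
rewrite (_ : _ + _ = (inner f f * inner g g - inner f g ^+ 2) / inner g g).
  by rewrite pmulr_lge0 ?invr_gt0// subr_ge0.
by field.
Qed.

(** Cauchy-Schwarz for f - E f and g - E g. *)
Lemma covariance_cauchy_schwarz f g :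
  f \in Lfun P 2%:E -> g \in Lfun P 2%:E ->
  (inner f g - inner f (cst 1) * inner g (cst 1)) ^+ 2 <=
  (inner f f - inner f (cst 1) ^+ 2) * (inner g g - inner g (cst 1) ^+ 2).
Proof.
move=> Lf Lg.
have L1 : cst 1 \in Lfun P 2%:E by exact: Lfun_cst.
have := inner_cauchy_schwarz (Lfun2_lin (- inner f (cst 1)) Lf L1)
  (Lfun2_lin (- inner g (cst 1)) Lg L1).
rewrite !inner_linl ?inner_linr ?Lfun2_lin// !(innerC _ (cst 1)) inner11.
by congr (_ <= _); ring.
Qed.

(** The squared norm of f minus its projection on the span of the y j is
    nonnegative.  A function y j of norm 0 contributes 0, by the convention
    x / 0 = 0. *)
Lemma bessel (J : finType) (y : J -> T -> R) (e : J -> R) f :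
  f \in Lfun P 2%:E -> (forall j, y j \in Lfun P 2%:E) ->
  (forall j l, inner (y j) (y l) = (j == l)%:R * e j) ->
  \sum_j inner f (y j) ^+ 2 / e j <= inner f f.
Proof.
move=> Lf Ly orth.
pose K j := inner f (y j).
pose g z := \sum_j K j / e j * y j z.
have Lg : g \in Lfun P 2%:E.
  apply: Lfun2_sum => j.
  rewrite (_ : (fun x => _) = (K j / e j) \o* y j); last first.
    by apply/funext => x; rewrite /= mulrC.
  by apply: Lfun_scale; rewrite ?ler1n.
have inner_g h : h \in Lfun P 2%:E -> inner g h = \sum_j K j / e j * inner (y j) h.
  move=> Lh.
  rewrite -(Rintegral_lincomb _ (f := fun j z => y j z * h z)); last first.
    by move=> j; exact: inner_integrable.
  apply: eq_Rintegral => z _; rewrite mulr_suml; apply: eq_bigr => j _.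
  by rewrite mulrA.
have inner_gf : inner g f = \sum_j K j ^+ 2 / e j.
  by rewrite inner_g//; apply: eq_bigr => j _; rewrite innerC -/(K j); ring.
have inner_gg : inner g g = \sum_j K j ^+ 2 / e j.
  rewrite inner_g//; apply: eq_bigr => j _; rewrite innerC inner_g//.
  rewrite (bigD1 j)//= big1 ?addr0 => [|l /negbTE lj]; last first.
    by rewrite orth lj mul0r mulr0.
  rewrite orth eqxx mul1r; have [->|e0] := eqVneq (e j) 0.
    by rewrite invr0 !mulr0.
  by field.
have := inner_ge0 (fun z => f z + -1 * g z).
rewrite inner_linl ?inner_linr ?Lfun2_lin// (innerC f g) inner_gf inner_gg.
by move: (\sum_j _) => s; lra.
Qed.

End square_integrable.

(** * The double integral of the squared cost *)

Section quadratic_cost.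
Context {R : realType} d (T : measurableType d) (P : probability T R).

(** For each fixed z' the inner integrand is a finite combination of products
    phi j * phi l, so as a function of z' the inner integral is such a
    combination of the products psi j * psi l. *)
Lemma iterated_integral_sqr (J : finType) (phi psi : J -> T -> R) :
  (forall j, phi j \in Lfun P 2%:E) -> (forall j, psi j \in Lfun P 2%:E) ->
  (\int[P]_z' \int[P]_z ((\sum_j phi j z * psi j z') ^+ 2)%:E =
   (\sum_j \sum_l inner P (phi j) (phi l) * inner P (psi j) (psi l))%:E)%E.
Proof.
move=> Lphi Lpsi.
have inner_integral z' : (\int[P]_z ((\sum_j phi j z * psi j z') ^+ 2)%:E =
    (\sum_(p : J * J) inner P (phi p.1) (phi p.2) * (psi p.1 z' * psi p.2 z'))%:E)%E.
  rewrite (_ : \sum_(p : J * J) _ = \sum_(p : J * J)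
      (psi p.1 z' * psi p.2 z') * inner P (phi p.1) (phi p.2)); last first.
    by apply: eq_bigr => p _; rewrite mulrC.
  rewrite -(integral_lincomb (fun p : J * J => psi p.1 z' * psi p.2 z')
      (f := fun p x => phi p.1 x * phi p.2 x)); last first.
    by move=> p; exact: inner_integrable.
  apply: eq_integral => z _; rewrite expr2 big_distrlr/= pair_bigA/=.
  by congr EFin; apply: eq_bigr => p _; ring.
under eq_integral do rewrite inner_integral.
rewrite (integral_lincomb (fun p : J * J => inner P (phi p.1) (phi p.2))
      (f := fun p x => psi p.1 x * psi p.2 x)); last first.
  by move=> p; exact: inner_integrable.
by rewrite pair_bigA.
Qed.

(** The special case of separated variables with the pairs (G, 1), (1, G) and
    (w k, - 2 sgn k w k); the mixed terms between the first two pairs and the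
    others contain a factor E[w k] = 0. *)
Lemma quadratic_cost_integral (K : finType) (sgn : K -> R) (w : K -> T -> R)
    (G : T -> R) :
  G \in Lfun P 2%:E -> (forall k, w k \in Lfun P 2%:E) ->
  (forall k, inner P (w k) (cst 1) = 0) ->
  (\int[P]_z' \int[P]_z ((G z + G z' - 2 * \sum_k sgn k * w k z * w k z') ^+ 2)%:E =
   (2 * inner P G G + 2 * inner P G (cst 1) ^+ 2
    + 4 * \sum_k \sum_l sgn k * sgn l * inner P (w k) (w l) ^+ 2)%:E)%E.
Proof.
move=> LG Lw w0.
have innerZ f g a b : f \in Lfun P 2%:E -> g \in Lfun P 2%:E ->
    inner P (fun x => a * f x) (fun x => b * g x) = a * b * inner P f g.
  move=> Lf Lg; rewrite /inner -RintegralZl//; last exact: inner_integrable.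
  by apply: eq_Rintegral => x _; ring.
have inner1w k b : inner P (cst 1) (fun x => b * w k x) = 0.
  rewrite (_ : cst 1 = fun x => 1 * cst 1 x); last by apply/funext => x; rewrite mul1r.
  by rewrite innerZ ?Lfun_cst// innerC w0 mulr0.
pose phi (j : bool + K) := match j with
  inl b => if b then G else cst 1 | inr k => w k end.
pose psi (j : bool + K) := match j with
  inl b => if b then cst 1 else G | inr k => (fun x => - 2 * sgn k * w k x) end.
have Lphi j : phi j \in Lfun P 2%:E by case: j => [[]|k] //=; exact: Lfun_cst.
have Lpsi j : psi j \in Lfun P 2%:E.
  case: j => [[]|k] //=; first exact: Lfun_cst.
  under eq_fun do rewrite mulrC.
  by apply: (@Lfun_scale _ _ _ P (w k)); rewrite ?ler1n.
transitivity (\int[P]_z' \int[P]_z ((\sum_j phi j z * psi j z') ^+ 2)%:E)%E.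
  apply: eq_integral => z' _; apply: eq_integral => z _.
  congr (_ ^+ 2)%:E; rewrite big_sumType/= big_bool/= mulr1 mul1r mulr_sumr -sumrN.
  by congr (_ + _); apply: eq_bigr => k _; ring.
rewrite iterated_integral_sqr//; congr EFin.
rewrite big_sumType/= big_bool/= !big_sumType/= !big_bool/= inner11.
have -> : \sum_k inner P G (w k) * inner P (cst 1) (fun x => - 2 * sgn k * w k x) = 0.
  by apply: big1 => k _; rewrite inner1w mulr0.
have -> : \sum_k inner P (cst 1) (w k) * inner P G (fun x => - 2 * sgn k * w k x) = 0.
  by apply: big1 => k _; rewrite innerC w0 mul0r.
rewrite (innerC _ (cst 1) G).
under eq_bigr => k _.
  rewrite big_sumType/= big_bool/= (innerC _ _ (cst 1)) inner1w mulr0 w0 mul0r !add0r.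
  over.
have -> : \sum_k \sum_l inner P (w k) (w l) * inner P (fun x => - 2 * sgn k * w k x)
    (fun x => - 2 * sgn l * w l x) =
    4 * \sum_k \sum_l sgn k * sgn l * inner P (w k) (w l) ^+ 2.
  rewrite mulr_sumr; apply: eq_bigr => k _; rewrite mulr_sumr.
  by apply: eq_bigr => l _; rewrite innerZ//; ring.
by ring.
Qed.

End quadratic_cost.

(** * Centred Gaussian families with uncorrelated coordinates *)

Section normal_family.
Context {R : realType} d (T : measurableType d) (P : probability T R).

(** The part of the law N(0, v) that the double integral of the cost sees. *)
Definition centered_normal_moments (f : T -> R) (v : R) :=
  [/\ measurable_fun setT f,
      forall k, P.-integrable setT (fun z => (f z ^+ k)%:E),
      \int[P]_z f z = 0,
      \int[P]_z f z ^+ 2 = v &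
      \int[P]_z f z ^+ 4 = 3 * v ^+ 2].

Variables (J : finType) (x : J -> T -> R) (e : J -> R).

(** The moments of a Gaussian vector with covariance diag(e), required of every
    linear form at once so that mixed moments can be recovered by
    polarization. *)
Definition centered_normal_family := forall c : J -> R,
  centered_normal_moments (fun z => \sum_j c j * x j z) (\sum_j e j * c j ^+ 2).

Hypothesis xe : centered_normal_family.

Let sum_dirac (f : J -> R) i : \sum_j (j == i)%:R * f j = f i.
Proof.
rewrite (bigD1 i)//= eqxx mul1r big1 ?addr0// => j /negbTE ->.
by rewrite mul0r.
Qed.

Let single i : centered_normal_moments (x i) (e i).
Proof.
have := xe (fun j => (j == i)%:R).
rewrite (_ : (fun z => _) = x i); last by apply/funext => z; rewrite sum_dirac.
rewrite (_ : \sum_j _ = e i)// -[RHS]sum_dirac; apply: eq_bigr => j _.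
by case: (j == i) => /=; ring.
Qed.

Let pair i j s : i != j ->
  centered_normal_moments (fun z => x i z + s * x j z) (e i + s ^+ 2 * e j).
Proof.
move=> ij; have := xe (fun l => (l == i)%:R + s * (l == j)%:R).
rewrite (_ : (fun z => _) = (fun z => x i z + s * x j z)); last first.
  apply/funext => z; under eq_bigr do rewrite mulrDl -mulrA.
  by rewrite big_split/= -mulr_sumr !sum_dirac.
rewrite (_ : \sum_l _ = e i + s ^+ 2 * e j)//.
rewrite -(sum_dirac e i) -(sum_dirac e j) mulr_sumr -big_split/=.
apply: eq_bigr => l _; have [->|_] := eqVneq l i.
  by rewrite (negbTE ij)/=; ring.
by case: (l == j) => /=; ring.
Qed.

Lemma normal_family_Lfun2 i : x i \in Lfun P 2%:E.
Proof. by have [mx ix _ _ _] := single i; apply: Lfun2_of_sqr => //; exact: ix. Qed.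

Lemma normal_family_mean i : inner P (x i) (cst 1) = 0.
Proof.
have [_ _ <- _ _] := single i.
by apply: eq_Rintegral => z _; rewrite mulr1.
Qed.

Lemma normal_family_sqr_Lfun2 i : (fun z => x i z ^+ 2) \in Lfun P 2%:E.
Proof.
have [mx ix _ _ _] := single i; apply: Lfun2_of_sqr.
  exact: measurable_funX.
by under eq_fun do rewrite /= -exprM; exact: ix.
Qed.

Let integrable_xsqr i j : P.-integrable setT (fun z => (x i z ^+ 2 * x j z ^+ 2)%:E).
Proof. by apply: inner_integrable; exact: normal_family_sqr_Lfun2. Qed.

Let comb2 (f g : T -> R) (a b : R) : P.-integrable setT (EFin \o f) ->
  P.-integrable setT (EFin \o g) ->
  \int[P]_z (a * f z + b * g z) = a * \int[P]_z f z + b * \int[P]_z g z.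
Proof.
move=> intf intg.
have := @Rintegral_lincomb _ _ _ P bool (fun l => if l then a else b)
  (fun l => if l then f else g).
rewrite big_bool/= => <-; last by case.
by apply: eq_Rintegral => z _; rewrite big_bool.
Qed.

Let int_comb2 (f g : T -> R) (a b : R) : P.-integrable setT (EFin \o f) ->
  P.-integrable setT (EFin \o g) ->
  P.-integrable setT (EFin \o (fun z => a * f z + b * g z)).
Proof.
move=> intf intg.
rewrite (_ : EFin \o _ = (fun z => a%:E * (EFin \o f) z + b%:E * (EFin \o g) z)%E)//.
by apply: integrableD => //; exact: integrableZl.
Qed.

(** Polarization: 4 x y = (x + y)^2 - (x - y)^2. *)
Lemma normal_family_cov i j : inner P (x i) (x j) = (i == j)%:R * e i.
Proof.
have [->|ij] := eqVneq i j.
  rewrite mul1r; have [_ _ _ <- _] := single j.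
  by apply: eq_Rintegral => z _; rewrite expr2.
have [_ intp _ vp _] := pair 1 ij; have [_ intm _ vm _] := pair (- 1) ij.
transitivity (\int[P]_z (4^-1 * (x i z + 1 * x j z) ^+ 2
    + (- 4^-1) * (x i z + -1 * x j z) ^+ 2)).
  by apply: eq_Rintegral => z _; field.
by rewrite comb2 ?vp ?vm; [rewrite mul0r; field|exact: intp|exact: intm].
Qed.

(** Polarization in degree 4:
    (x + y)^4 + (x - y)^4 = 2 x^4 + 2 y^4 + 12 x^2 y^2. *)
Lemma normal_family_sqr_cov i j :
  inner P (fun z => x i z ^+ 2) (fun z => x j z ^+ 2) =
  e i * e j + (i == j)%:R * (2 * e i ^+ 2).
Proof.
have [->|ij] := eqVneq i j.
  transitivity (\int[P]_z x j z ^+ 4).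
    by apply: eq_Rintegral => z _ /=; ring.
  by have [_ _ _ _ ->] := single j; rewrite /=; ring.
have [_ intp _ _ vp] := pair 1 ij; have [_ intm _ _ vm] := pair (- 1) ij.
have [_ ii _ _ vi] := single i; have [_ jj _ _ vj] := single j.
have polar : \int[P]_z (1 * (x i z + 1 * x j z) ^+ 4
      + 1 * (x i z + -1 * x j z) ^+ 4) =
    \int[P]_z (1 * (2 * x i z ^+ 4 + 2 * x j z ^+ 4)
      + 12 * (x i z ^+ 2 * x j z ^+ 2)).
  by apply: eq_Rintegral => z _ /=; ring.
move: polar; rewrite comb2; [|exact: intp|exact: intm].
rewrite comb2; [|exact: int_comb2 (ii 4%N) (jj 4%N)|exact: integrable_xsqr].
rewrite comb2; [|exact: ii|exact: jj].
rewrite vp vm vi vj -/(inner P (fun z => x i z ^+ 2) (fun z => x j z ^+ 2)) => h.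
rewrite mul0r addr0; lra.
Qed.

End normal_family.

Section normal_family_sqnorm.
Context {R : realType} d (T : measurableType d) (P : probability T R).
Variables (J : finType) (x : J -> T -> R) (e : J -> R).
Hypothesis xe : centered_normal_family P x e.

Let A z := \sum_j x j z ^+ 2.

Lemma sqnorm_Lfun2 : A \in Lfun P 2%:E.
Proof. by apply: Lfun2_sum => j; exact: (normal_family_sqr_Lfun2 xe). Qed.

Lemma sqnorm_mean : inner P A (cst 1) = \sum_j e j.
Proof.
transitivity (\int[P]_z (\sum_j 1 * (x j z * x j z))).
  apply: eq_Rintegral => z _; rewrite mulr1.
  by apply: eq_bigr => j _; rewrite mul1r expr2.
rewrite (Rintegral_lincomb (fun=> 1) (f := fun j z => x j z * x j z)); last first.
  by move=> j; apply: inner_integrable; exact: (normal_family_Lfun2 xe).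
apply: eq_bigr => j _; rewrite mul1r -/(inner P (x j) (x j)).
by rewrite (normal_family_cov xe) eqxx mul1r.
Qed.

(** Equivalently, the variance of the squared norm of a Gaussian vector is twice
    the squared Frobenius norm of its covariance. *)
Lemma sqnorm_sqr : inner P A A = (\sum_j e j) ^+ 2 + 2 * \sum_j e j ^+ 2.
Proof.
transitivity (\int[P]_z (\sum_(p : J * J) 1 * (x p.1 z ^+ 2 * x p.2 z ^+ 2))).
  apply: eq_Rintegral => z _; rewrite big_distrlr/= pair_bigA/=.
  by apply: eq_bigr => p _; rewrite mul1r.
rewrite (Rintegral_lincomb (fun=> 1)
  (f := fun p z => x p.1 z ^+ 2 * x p.2 z ^+ 2)); last first.
  by move=> p; apply: inner_integrable; exact: (normal_family_sqr_Lfun2 xe).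
rewrite expr2 big_distrlr/= pair_bigA/= mulr_sumr.
have -> : \sum_j 2 * e j ^+ 2 = \sum_(p : J * J) (p.1 == p.2)%:R * (2 * e p.1 ^+ 2).
  rewrite -(pair_bigA _ (fun i j => (i == j)%:R * (2 * e i ^+ 2)))/=.
  apply: eq_bigr => i _; rewrite (bigD1 i)//= eqxx mul1r big1 ?addr0// => j.
  by rewrite eq_sym => /negbTE ->; rewrite mul0r.
rewrite -big_split/=; apply: eq_bigr => p _.
by rewrite mul1r; exact: (normal_family_sqr_cov xe).
Qed.

End normal_family_sqnorm.

(** * Gaussian laws in eigencoordinates *)

Section gaussian_coordinates.
Context {R : realType} (d : nat).
Implicit Types (x a : d.-tuple R) (P S D : 'M[R]_d).

(** The i-th entry of P^T (x - a). *)
Definition coord P a (i : 'I_d) x : R :=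
  \sum_k P k i * (tnth x k - tnth a k).

Lemma norm2_sub_coord P a x x' : orthogonal_mx P ->
  norm2 (subt x x') ^+ 2 = \sum_i (coord P a i x - coord P a i x') ^+ 2.
Proof.
move=> [PPt _]; rewrite /norm2 sqr_sqrtr; last first.
  by apply: sumr_ge0 => i _; rewrite -expr2 sqr_ge0.
pose y k := tnth x k - tnth x' k.
have -> : dotp (subt x x') (subt x x') = \sum_k y k * y k.
  by apply: eq_bigr => k _; rewrite !tnth_mktuple.
have coordB i : coord P a i x - coord P a i x' = \sum_k P k i * y k.
  by rewrite -sumrB; apply: eq_bigr => k _; rewrite /y; ring.
under [RHS]eq_bigr do rewrite coordB expr2 big_distrlr/=.
rewrite exchange_big/=; apply: eq_bigr => k _.
rewrite exchange_big/=.
transitivity (\sum_l (P *m P^T) k l * (y k * y l)).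
  rewrite PPt (bigD1 k)//= !mxE eqxx mul1r big1 ?addr0// => l /negbTE lk.
  by rewrite !mxE eq_sym lk mul0r.
apply: eq_bigr => l _; rewrite !mxE mulr_suml; apply: eq_bigr => i _.
by rewrite mxE; ring.
Qed.

(** The vector P c. *)
Definition rotate P (c : 'I_d -> R) : d.-tuple R :=
  [tuple \sum_i P k i * c i | k < d].

Lemma dotp_rotate P a x (c : 'I_d -> R) :
  dotp (rotate P c) x - dotp (rotate P c) a = \sum_i c i * coord P a i x.
Proof.
rewrite /dotp -sumrB.
transitivity (\sum_k \sum_i c i * (P k i * (tnth x k - tnth a k))).
  apply: eq_bigr => k _; rewrite tnth_mktuple -mulrBr mulr_suml.
  by apply: eq_bigr => i _; ring.
by rewrite exchange_big/=; apply: eq_bigr => i _; rewrite mulr_sumr.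
Qed.

Lemma quadform_rotate S P D (c : 'I_d -> R) : sorted_diagonalization S P D ->
  quadform S (rotate P c) = \sum_i D i i * c i ^+ 2.
Proof.
move=> [[_ PtP] /is_diag_mxP Ddiag _ ->].
pose w : 'cV[R]_d := \col_i c i.
have uE i : tnth (rotate P c) i = (P *m w) i 0.
  by rewrite tnth_mktuple !mxE; apply: eq_bigr => k _; rewrite mxE.
have -> : quadform (P *m D *m P^T) (rotate P c) =
    ((P *m w)^T *m (P *m D *m P^T) *m (P *m w)) 0 0.
  rewrite mxE /quadform exchange_big/=; apply: eq_bigr => j _.
  rewrite mxE mulr_suml; apply: eq_bigr => i _.
  by rewrite !uE [(_ ^T) 0 i]mxE.
have -> : (P *m w)^T *m (P *m D *m P^T) *m (P *m w) = w^T *m D *m w.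
  rewrite trmx_mul -!mulmxA [P^T *m (P *m w)]mulmxA PtP mul1mx.
  by rewrite [P^T *m (P *m _)]mulmxA PtP mul1mx.
rewrite mxE; apply: eq_bigr => j _; rewrite [w j 0]mxE mxE (bigD1 j)//= big1 ?addr0.
  by rewrite !mxE; ring.
by move=> i ij; rewrite Ddiag ?mulr0// eq_sym.
Qed.

Lemma measurable_dotp (u : d.-tuple R) : measurable_fun setT (dotp u).
Proof.
apply: measurable_sum => i; apply: measurable_funM => //.
exact: measurable_tnth.
Qed.

(** A linear form in the coordinates is a linear form in the original vector,
    with direction P c, whose variance is c^T D c since P^T P = 1. *)
Lemma gaussian_coord_family disp (T : measurableType disp) (Q : probability T R)
    (X : T -> d.-tuple R) (mu : set (d.-tuple R) -> \bar R) a S P D :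
  measurable_fun setT X ->
  (forall A, measurable A -> Q (X @^-1` A) = mu A) ->
  is_gaussian mu a S -> sorted_diagonalization S P D ->
  centered_normal_family Q (fun i z => coord P a i (X z)) (fun i => D i i).
Proof.
move=> mX lawX [_ S0 lawS] SPD c.
have mf : measurable_fun setT (fun z => dotp (rotate P c) (X z)).
  exact: measurableT_comp (measurable_dotp _) mX.
have lawf (B : set R) : measurable B ->
    Q ((fun z => dotp (rotate P c) (X z)) @^-1` B) =
    normal1 (dotp (rotate P c) a) (quadform S (rotate P c)) B.
  move=> mB; rewrite -lawS// -lawX//.
  by rewrite -[X in measurable X]setTI; exact: measurable_dotp.
have [ik k1 k2 k4] := normal1_moments mf (S0 _) lawf.
rewrite -(quadform_rotate c SPD).
have fE : (fun z => \sum_i c i * coord P a i (X z)) =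
    (fun z => dotp (rotate P c) (X z) - dotp (rotate P c) a).
  by apply/funext => z; rewrite dotp_rotate.
rewrite fE; split => //; exact: measurable_funB.
Qed.

End gaussian_coordinates.

(** * Sums against doubly substochastic weights *)

Section rearrangement.
Context {R : realType}.

(** A feasible dual solution of the assignment problem with gains a i * b j whose
    value is that of the diagonal assignment.  The potentials u and v are the
    two halves of the summation-by-parts splitting
    a k b k - a (k+1) b (k+1) = (a k - a (k+1)) b k + a (k+1) (b k - b (k+1));
    monotonicity of a and b makes them feasible off the diagonal. *)
Lemma dual_potentials (a b : nat -> R) (n : nat) :
  (forall k, 0 <= a k) -> (forall k, a k.+1 <= a k) ->
  (forall k, 0 <= b k) -> (forall k, b k.+1 <= b k) -> b n = 0 ->
  exists u v : nat -> R,
    [/\ forall i, 0 <= u i, forall j, 0 <= v j,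
        forall i, (n <= i)%N -> u i = 0,
        forall i, (i < n)%N -> u i + v i = a i * b i &
        forall i j, (j < n)%N -> a i * b j <= u i + v j].
Proof.
move=> a0 ad b0 bd bn.
have adec : {homo a : i j / (i <= j)%N >-> j <= i}.
  exact/nonincreasing_seqP.
have bdec : {homo b : i j / (i <= j)%N >-> j <= i}.
  exact/nonincreasing_seqP.
pose u i : R := \sum_(i <= k < n) (a k - a k.+1) * b k.
pose v j : R := \sum_(j <= k < n) a k.+1 * (b k - b k.+1).
have uS i : (i < n)%N -> u i = (a i - a i.+1) * b i + u i.+1.
  by move=> lin; rewrite /u big_ltn.
have vS j : (j < n)%N -> v j = a j.+1 * (b j - b j.+1) + v j.+1.
  by move=> ljn; rewrite /v big_ltn.
have u0 i : 0 <= u i by apply: sumr_ge0 => k _; rewrite mulr_ge0// subr_ge0.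
have v0 j : 0 <= v j by apply: sumr_ge0 => k _; rewrite mulr_ge0// subr_ge0.
have uv i : (i <= n)%N -> u i + v i = a i * b i.
  move=> lin; rewrite -(subKn lin); elim: (n - i)%N (leq_subr i n) => [|k IH] kn.
    by rewrite subn0 /u /v !big_geq// bn mulr0 addr0.
  have lk : (n - k.+1 < n)%N by rewrite ltn_subrL (leq_ltn_trans _ kn).
  have e : (n - k.+1).+1 = (n - k)%N by rewrite subnSK.
  rewrite uS// vS// e; have := IH (ltnW kn); lra.
exists u, v; split=> //.
- by move=> i ni; rewrite /u big_geq.
- by move=> i /ltnW; exact: uv.
move=> i j jn; have [ij|/ltnW ji] := leqP i j.
  (* Descend from the equality at (j, j), increasing u. *)
  rewrite -(subKn ij); elim: (j - i)%N (leq_subr i j) => [|k IH] kj.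
    by rewrite subn0 uv// ltnW.
  have lk : (j - k.+1 < n)%N by rewrite (leq_ltn_trans (leq_subr _ _)).
  have e : (j - k.+1).+1 = (j - k)%N by rewrite subnSK.
  have bb : b j <= b (j - k.+1)%N by apply: bdec; exact: leq_subr.
  rewrite uS// e; have := IH (ltnW kj); have := ad (j - k.+1)%N; rewrite e => h1 h2.
  by nra.
have [ni|lin] := leqP n i.
  (* Here u i = 0, and the descent starts from b n = 0. *)
  have : forall k, (k <= n)%N -> a i * b (n - k)%N <= u i + v (n - k)%N.
    elim=> [|k IH] kn; first by rewrite subn0 bn mulr0 addr_ge0.
    have lk : (n - k.+1 < n)%N by rewrite ltn_subrL (leq_ltn_trans _ kn).
    have e : (n - k.+1).+1 = (n - k)%N by rewrite subnSK.
    have aa : a i <= a (n - k)%N by apply: adec; rewrite (leq_trans (leq_subr _ _)).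
    rewrite vS// e; have := IH (ltnW kn); have := bd (n - k.+1)%N; rewrite e => h1 h2.
    by nra.
  by move=> /(_ (n - j)%N (leq_subr _ _)); rewrite subKn// ltnW.
rewrite -(subKn ji); elim: (i - j)%N (leq_subr j i) => [|k IH] ki.
  by rewrite subn0 uv// ltnW.
have lk : (i - k.+1 < n)%N by rewrite (leq_ltn_trans (leq_subr _ _)).
have e : (i - k.+1).+1 = (i - k)%N by rewrite subnSK.
have aa : a i <= a (i - k)%N by apply: adec; exact: leq_subr.
rewrite vS// e; have := IH (ltnW ki); have := bd (i - k.+1)%N; rewrite e => h1 h2.
by nra.
Qed.

(** Weak duality: replace each gain a i * b j by the larger u i + v j, then use
    that the rows and columns of S have mass at most 1. *)
Lemma doubly_substochastic_le (m n : nat) (le_nm : (n <= m)%N)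
    (a : 'I_m -> R) (b : 'I_n -> R) (S : 'I_m -> 'I_n -> R) :
  (forall i, 0 <= a i) -> (forall i j : 'I_m, (i <= j)%N -> a j <= a i) ->
  (forall j, 0 <= b j) -> (forall i j : 'I_n, (i <= j)%N -> b j <= b i) ->
  (forall i j, 0 <= S i j) ->
  (forall i, \sum_j S i j <= 1) -> (forall j, \sum_i S i j <= 1) ->
  \sum_i \sum_j a i * S i j * b j <= \sum_j a (widen_ord le_nm j) * b j.
Proof.
move=> a0 ad b0 bd S0 Srow Scol.
(* Extension by 0 to all natural numbers, which keeps both sequences
   nonincreasing and supplies the boundary value b n = 0. *)
pose ext q (f : 'I_q -> R) k := if insub k is Some i then f i else 0.
have extE q (f : 'I_q -> R) (i : 'I_q) : ext q f i = f i by rewrite /ext valK.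
have ext0 q (f : 'I_q -> R) k : (forall i, 0 <= f i) -> 0 <= ext q f k.
  by move=> f0; rewrite /ext; case: insub.
have extd q (f : 'I_q -> R) k : (forall i, 0 <= f i) ->
    (forall i j : 'I_q, (i <= j)%N -> f j <= f i) -> ext q f k.+1 <= ext q f k.
  move=> f0 fd; have [kq|qk] := ltnP k.+1 q; last first.
    by rewrite {1}/ext insubF ?ext0// ltnNge qk.
  have := extE q f (Ordinal kq); have := extE q f (Ordinal (ltnW kq)) => /= -> ->.
  exact: fd.
have extn q (f : 'I_q -> R) : ext q f q = 0 by rewrite /ext insubF// ltnn.
have [u [v [u0 v0 un uv auv]]] := dual_potentials
  (fun k => ext0 m a k a0) (fun k => extd m a k a0 ad)
  (fun k => ext0 n b k b0) (fun k => extd n b k b0 bd) (extn n b).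
apply: (@le_trans _ _ (\sum_(i < m) \sum_(j < n) (u i * S i j + v j * S i j))).
  apply: ler_sum => i _; apply: ler_sum => j _.
  rewrite -mulrDl mulrAC ler_wpM2r//.
  by have := auv i j (ltn_ord j); rewrite !extE.
apply: (@le_trans _ _ (\sum_(i < m) u i + \sum_(j < n) v j)).
  under eq_bigr do rewrite big_split/=.
  rewrite big_split/= [X in _ + X <= _]exchange_big/=.
  apply: lerD; apply: ler_sum => k _; rewrite -mulr_sumr ler_piMr//.
rewrite (_ : \sum_(i < m) u i = \sum_(j < n) u j); last first.
  rewrite -(subnKC le_nm) big_split_ord/= [X in _ + X]big1 ?addr0// => i _.
  by rewrite un// leq_addr.
rewrite -big_split/=; apply: ler_sum => j _.
rewrite uv ?ltn_ord// extE; have := extE m a (widen_ord le_nm j) => /= ->.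
by [].
Qed.

End rearrangement.

(** * Size of the cross-covariance *)

Section cross_covariance.
Context {R : realType} d (T : measurableType d) (P : probability T R).

(** The squared correlations have row and column sums at most 1 by Bessel's
    inequality for either family.  The extremal case is perfect correlation of
    the leading principal axes. *)
Lemma cross_covariance_le (m n : nat) (le_nm : (n <= m)%N)
    (x : 'I_m -> T -> R) (y : 'I_n -> T -> R) (a : 'I_m -> R) (b : 'I_n -> R) :
  (forall i, x i \in Lfun P 2%:E) -> (forall j, y j \in Lfun P 2%:E) ->
  (forall i k, inner P (x i) (x k) = (i == k)%:R * a i) ->
  (forall j l, inner P (y j) (y l) = (j == l)%:R * b j) ->
  (forall i j : 'I_m, (i <= j)%N -> a j <= a i) ->
  (forall i j : 'I_n, (i <= j)%N -> b j <= b i) ->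
  \sum_i \sum_j inner P (x i) (y j) ^+ 2 <= \sum_j a (widen_ord le_nm j) * b j.
Proof.
move=> Lx Ly xx yy ad bd.
have a0 i : 0 <= a i by have := inner_ge0 P (x i); rewrite xx eqxx mul1r.
have b0 j : 0 <= b j by have := inner_ge0 P (y j); rewrite yy eqxx mul1r.
(* The squared correlations.  Where a variance vanishes so does the covariance,
   by Cauchy-Schwarz, and S i j = 0 is consistent with that. *)
pose S i j := inner P (x i) (y j) ^+ 2 / (a i * b j).
apply: le_trans (@doubly_substochastic_le R m n le_nm a b S a0 ad b0 bd _ _ _).
- apply: ler_sum => i _; apply: ler_sum => j _.
  have := inner_cauchy_schwarz (Lx i) (Ly j); rewrite xx yy !eqxx !mul1r /S.
  have [->|ab0] := eqVneq (a i * b j) 0.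
    by rewrite invr0 !mulr0 mul0r.
  by move=> _; rewrite mulrAC [leRHS]mulrC divfK.
- by move=> i j; rewrite divr_ge0 ?sqr_ge0// mulr_ge0.
- move=> i; have [ai0|ai0] := eqVneq (a i) 0.
    by rewrite big1 ?ler01// => j _; rewrite /S ai0 mul0r invr0 mulr0.
  have aigt0 : 0 < a i by rewrite lt0r ai0 a0.
  rewrite (_ : \sum_j _ = (\sum_j inner P (x i) (y j) ^+ 2 / b j) / a i); last first.
    by rewrite mulr_suml; apply: eq_bigr => j _; rewrite /S invfM mulrA mulrAC.
  rewrite ler_pdivrMr// mul1r (le_trans (bessel (Lx i) Ly yy))//.
  by rewrite xx eqxx mul1r.
- move=> j; have [bj0|bj0] := eqVneq (b j) 0.
    by rewrite big1 ?ler01// => i _; rewrite /S bj0 mulr0 invr0 mulr0.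
  have bjgt0 : 0 < b j by rewrite lt0r bj0 b0.
  rewrite (_ : \sum_i _ = (\sum_i inner P (y j) (x i) ^+ 2 / a i) / b j); last first.
    by rewrite mulr_suml; apply: eq_bigr => i _; rewrite /S invfM mulrA innerC.
  rewrite ler_pdivrMr// mul1r (le_trans (bessel (Ly j) Lx xx))//.
  by rewrite yy eqxx mul1r.
Qed.

End cross_covariance.

(** * Diagonal matrices and the lower bound *)

Section frobenius.
Context {R : realType}.

Lemma frobenius_diag_sqr (n : nat) (M : 'M[R]_n) : is_diag_mx M ->
  frobenius M ^+ 2 = \sum_i M i i ^+ 2.
Proof.
move=> /is_diag_mxP Mdiag.
have trE : \tr (M^T *m M) = \sum_i M i i ^+ 2.
  apply: eq_bigr => i _; rewrite mxE (bigD1 i)//= mxE big1 ?addr0 ?expr2//.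
  by move=> j ji; rewrite Mdiag ?mulr0.
by rewrite /frobenius sqr_sqrtr trE// sumr_ge0// => i _; rewrite sqr_ge0.
Qed.

Lemma frobenius_sub_leading_submx (m n : nat) (le_nm : (n <= m)%N)
    (D : 'M[R]_m) (E : 'M[R]_n) : is_diag_mx D -> is_diag_mx E ->
  frobenius (leading_submx le_nm D - E) ^+ 2 =
  frobenius (leading_submx le_nm D) ^+ 2 + frobenius E ^+ 2
  - 2 * \sum_j D (widen_ord le_nm j) (widen_ord le_nm j) * E j j.
Proof.
move=> Ddiag Ediag.
have leaddiag : is_diag_mx (leading_submx le_nm D).
  apply/is_diag_mxP => j k jk; rewrite mxE.
  by move/is_diag_mxP: Ddiag; apply.
have diffdiag : is_diag_mx (leading_submx le_nm D - E).
  apply/is_diag_mxP => j k jk.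
  move/is_diag_mxP: leaddiag => /(_ j k jk) l0.
  rewrite mxE l0 mxE; move/is_diag_mxP: Ediag => ->//.
  by rewrite oppr0 addr0.
rewrite !frobenius_diag_sqr// mulr_sumr -big_split/= -sumrB.
by apply: eq_bigr => j _; rewrite !mxE; ring.
Qed.

End frobenius.

Theorem theorem3p1 (R : realType) (m n : nat) (le_nm : (n <= m)%N)
  (mu : probability (m.-tuple R) R) (nu : probability (n.-tuple R) R)
  (m0 : m.-tuple R) (m1 : n.-tuple R)
  (Sigma0 P0 D0 : 'M[R]_m) (Sigma1 P1 D1 : 'M[R]_n) :
  is_gaussian mu m0 Sigma0 ->
  is_gaussian nu m1 Sigma1 ->
  sorted_diagonalization Sigma0 P0 D0 ->
  sorted_diagonalization Sigma1 P1 D1 ->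
  Sigma0 \in unitmx ->
  ((LGW2_sq le_nm D0 D1)%:E <= GW2_sq mu nu)%E.
Proof.
move=> gmu gnu diag0 diag1 _.
apply: le_ereal_inf_tmp => _ [pi [pimu pinu] <-].
have [orth0 D0diag D0dec _] := diag0; have [orth1 D1diag D1dec _] := diag1.
pose x i (z : m.-tuple R * n.-tuple R) := coord P0 m0 i z.1.
pose y j (z : m.-tuple R * n.-tuple R) := coord P1 m1 j z.2.
pose a i := D0 i i; pose b j := D1 j j.
have xa : centered_normal_family pi x a.
  exact: gaussian_coord_family measurable_fst pimu gmu diag0.
have yb : centered_normal_family pi y b.
  exact: gaussian_coord_family measurable_snd pinu gnu diag1.
have Lx := normal_family_Lfun2 xa; have Ly := normal_family_Lfun2 yb.
have xx := normal_family_cov xa; have yy := normal_family_cov yb.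
pose A z := \sum_i x i z ^+ 2; pose B z := \sum_j y j z ^+ 2.
have LA : A \in Lfun pi 2%:E := sqnorm_Lfun2 xa.
have LB : B \in Lfun pi 2%:E := sqnorm_Lfun2 yb.
have L1 : cst 1 \in Lfun pi 2%:E by exact: Lfun_cst.
pose G z := A z + -1 * B z.
have LG : G \in Lfun pi 2%:E by exact: Lfun2_lin.
pose w (k : 'I_m + 'I_n) := match k with inl i => x i | inr j => y j end.
pose sgn (k : 'I_m + 'I_n) : R := if k is inl _ then 1 else -1.
have Lw k : w k \in Lfun pi 2%:E by case: k.
have w0 k : inner pi (w k) (cst 1) = 0.
  by case: k => k; [exact: normal_family_mean xa _|exact: normal_family_mean yb _].
have costE z z' : GW2_cost z z' =
    (G z + G z' - 2 * \sum_k sgn k * w k z * w k z') ^+ 2.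
  rewrite /GW2_cost (norm2_sub_coord m0 _ _ orth0) (norm2_sub_coord m1 _ _ orth1).
  congr (_ ^+ 2); rewrite big_sumType/= /G /A /B.
  have sqB (I : finType) (f : I -> m.-tuple R * n.-tuple R -> R) :
      \sum_i (f i z - f i z') ^+ 2 =
      \sum_i f i z ^+ 2 + \sum_i f i z' ^+ 2 - 2 * \sum_i f i z * f i z'.
    by rewrite mulr_sumr -big_split/= -sumrB; apply: eq_bigr => i _; ring.
  rewrite (sqB _ x) (sqB _ y).
  under [X in _ = _ - 2 * (X + _)]eq_bigr do rewrite mul1r.
  under [X in _ = _ - 2 * (_ + X)]eq_bigr do rewrite mulN1r mulNr.
  by rewrite sumrN; ring.
under eq_integral do under eq_integral do rewrite costE.
rewrite quadratic_cost_integral// lee_fin.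
pose p := \sum_i a i ^+ 2; pose q := \sum_j b j ^+ 2.
pose alpha := \sum_i a i; pose beta := \sum_j b j.
pose kappa := \sum_i \sum_j inner pi (x i) (y j) ^+ 2.
pose rho := \sum_j a (widen_ord le_nm j) * b j.
have kappa_rho : kappa <= rho by exact: cross_covariance_le.
have diag_sum (I : finType) (f : I -> m.-tuple R * n.-tuple R -> R) (c : I -> R) :
    (forall i k, inner pi (f i) (f k) = (i == k)%:R * c i) ->
    \sum_i \sum_k inner pi (f i) (f k) ^+ 2 = \sum_i c i ^+ 2.
  move=> ff; apply: eq_bigr => i _; rewrite (bigD1 i)//= ff eqxx mul1r.
  rewrite big1 ?addr0// => k /negbTE; rewrite eq_sym ff => ->.
  by rewrite mul0r expr0n.
have covE : \sum_k \sum_l sgn k * sgn l * inner pi (w k) (w l) ^+ 2 = p + q - 2 * kappa.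
  rewrite big_sumType/=.
  under eq_bigr do rewrite big_sumType/=.
  under [X in _ + X = _]eq_bigr do rewrite big_sumType/=.
  rewrite !big_split/=.
  have -> : \sum_i \sum_k 1 * 1 * inner pi (x i) (x k) ^+ 2 = p.
    by rewrite /p -(diag_sum _ _ _ xx); do 2 apply: eq_bigr => ? _; ring.
  have -> : \sum_i \sum_k -1 * -1 * inner pi (y i) (y k) ^+ 2 = q.
    by rewrite /q -(diag_sum _ _ _ yy); do 2 apply: eq_bigr => ? _; ring.
  have -> : \sum_i \sum_j 1 * -1 * inner pi (x i) (y j) ^+ 2 = - kappa.
    rewrite /kappa -sumrN; apply: eq_bigr => ? _; rewrite -sumrN.
    by apply: eq_bigr => ? _; ring.
  have -> : \sum_j \sum_i -1 * 1 * inner pi (y j) (x i) ^+ 2 = - kappa.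
    rewrite exchange_big /kappa -sumrN; apply: eq_bigr => ? _; rewrite -sumrN.
    by apply: eq_bigr => ? _; rewrite innerC; ring.
  by ring.
have A1 : inner pi A (cst 1) = alpha := sqnorm_mean xa.
have B1 : inner pi B (cst 1) = beta := sqnorm_mean yb.
have AA : inner pi A A = alpha ^+ 2 + 2 * p := sqnorm_sqr xa.
have BB : inner pi B B = beta ^+ 2 + 2 * q := sqnorm_sqr yb.
have G1 : inner pi G (cst 1) = alpha - beta.
  by rewrite inner_linl// A1 B1; ring.
have GG : inner pi G G = inner pi A A + inner pi B B - 2 * inner pi A B.
  by rewrite inner_linl ?inner_linr// (innerC _ B A); ring.
have F0 : frobenius D0 ^+ 2 = p by exact: frobenius_diag_sqr.
have F1 : frobenius D1 ^+ 2 = q by exact: frobenius_diag_sqr.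
have f0 : 0 <= frobenius D0 by exact: sqrtr_ge0.
have f1 : 0 <= frobenius D1 by exact: sqrtr_ge0.
(* The variances of A and B are 2 p and 2 q. *)
have covAB : inner pi A B - alpha * beta <= 2 * frobenius D0 * frobenius D1.
  have := covariance_cauchy_schwarz LA LB; rewrite A1 B1 AA BB => cs.
  rewrite (le_trans (ler_norm _))// -(@ler_pXn2r _ 2) ?nnegrE ?mulr_ge0//.
  rewrite real_normK ?num_real// (le_trans cs)// -F0 -F1.
  by rewrite le_eqVlt; apply/orP; left; apply/eqP; ring.
have diffE : frobenius (leading_submx le_nm D0 - D1) ^+ 2 =
    frobenius (leading_submx le_nm D0) ^+ 2 + q - 2 * rho.
  by rewrite frobenius_sub_leading_submx// F1.
rewrite /LGW2_sq diffE covE GG G1 AA BB.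
rewrite -[\tr D0]/alpha -[\tr D1]/beta.
move: covAB kappa_rho F0 F1.
move: (frobenius D0) (frobenius D1) (frobenius _) f0 f1 => s t r s0 t0 *.
by nra.
Qed.
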